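(* $\le_T^{O}\ \not\subseteq\ \le_T^{U}$, i.e., there exist sets $X,Y$ with $X\le_T^{O}Y$ and $X\not\le_T^{U}Y$.
   Context: An NPTM is a nondeterministic oracle Turing machine $N$ each of whose computation paths ends in one of three outcomes $\mathbf{acc}$, $\mathbf{rej}$, $\mathbf{?}$, such that there is a polynomial $p$ with: for every oracle $D$ and every input $x$, every computation path of $N^D(x)$ has length at most $p(|x|)$. For an oracle $D$ and input $x$, let $out_{N^D}(x)$ be the set of outcomes occurring on some path of $N^D(x)$; $L(N^D)=\{x:\mathbf{acc}\in out_{N^D}(x)\}$. $N^D(x)$ is underproductive if $\{\mathbf{acc},\mathbf{rej}\}\not\subseteq out_{N^D}(x)$, and overproductive if $out_{N^D}(x)\neq\{\mathbf{?}\}$; $N^D$ is underproductive (overproductive) if $N^D(x)$ is so for every $x$. $N$ is robustly underproductive (overproductive) if $N^D$ is underproductive (overproductive) for every oracle $D$. $A\le_T^{SN}B$ if there is an NPTM $N$ with $N^B$ both overproductive and underproductive and $A=L(N^B)$. $A\le_T^{U}B$ if $A\le_T^{SN}B$ via an $N$ that is robustly underproductive. $A\le_T^{O}B$ if $A\le_T^{SN}B$ via an $N$ that is robustly overproductive. A reducibility is identified with the set of pairs $(A,B)$ it relates. *)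

(* Defs.v *)
From HB Require Import structures.
From mathcomp Require Import all_boot all_order all_algebra.
From mathcomp Require Import boolp classical_sets.

Set Implicit Arguments.
Unset Strict Implicit.
Unset Printing Implicit Defensive.

Local Open Scope classical_set_scope.

Definition word := seq bool.
Definition language := set word.

Inductive outcome := Acc | Rej | Quest.

Inductive direction := GoLeft | Stay | GoRight.

Definition direction_code (d : direction) : option bool :=
  match d with GoLeft => Some false | Stay => None | GoRight => Some true end.

Definition direction_decode (o : option bool) : direction :=
  match o with Some false => GoLeft | None => Stay | Some true => GoRight end.

Lemma direction_codeK : cancel direction_code direction_decode.
Proof. by case. Qed.

HB.instance Definition _ := Finite.copy direction (can_type direction_codeK).

(* Tape alphabet: [None] is the blank, [Some (inl b)] an input bit, and
   [Some (inr g)] one of the machine's own auxiliary symbols. *)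
Definition symbol (G : finType) := option (bool + G).

(* A two-way infinite tape. The head scans the first cell of [rightward];
   [leftward] lists the cells to its left, nearest first. All cells beyond
   these two lists are blank. *)
Record tape (G : finType) := Tape {
  leftward : seq (symbol G);
  rightward : seq (symbol G)
}.

Definition read (G : finType) (t : tape G) : symbol G :=
  head None (rightward t).

Definition write_move (G : finType) (a : symbol G * direction) (t : tape G) :
    tape G :=
  let l := leftward t in
  let r := behead (rightward t) in
  match a.2 with
  | GoLeft => Tape (behead l) (head None l :: a.1 :: r)
  | Stay => Tape l (a.1 :: r)
  | GoRight => Tape (a.1 :: l) r
  end.

(* One ordinary step: the next state, what to write on each of the [k] tapes
   and where to move its head, and possibly one bit to append to the query. *)
Definition action (Q G : finType) (k : nat) : finType :=
  (Q * {ffun 'I_k -> symbol G * direction} * option bool)%type.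

Inductive instruction (Q G : finType) (k : nat) :=
| Halt of outcome
| Query of Q & Q
| Act of ({ffun 'I_k -> symbol G} -> {set action Q G k}).
Arguments Halt {Q G k}.
Arguments Query {Q G k}.

(* Nondeterministic oracle Turing machines with [extra_tapes.+1] read-write
   tapes, the input being on tape [ord0], and a write-only oracle tape, which
   is erased by each query. A state [q] with [program q = Query y n] asks
   whether the word on the oracle tape is in the oracle, and goes to [y] if it
   is and to [n] if it is not. *)
Record machine := Machine {
  state : finType;
  aux_symbol : finType;
  extra_tapes : nat;
  start : state;
  program : state -> instruction state aux_symbol extra_tapes.+1
}.

Record config (N : machine) := Config {
  cfg_state : state N;
  cfg_tapes : {ffun 'I_(extra_tapes N).+1 -> tape (aux_symbol N)};
  cfg_query : word
}.

Definition init_config (N : machine) (x : word) : config N :=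
  Config (start N)
    [ffun i => Tape [::] (if i == ord0 then [seq Some (inl b) | b <- x]
                          else [::])]
    [::].

Inductive step (N : machine) (D : language) : config N -> config N -> Prop :=
| step_act (q q' : state N) acts
    (f : {ffun 'I_(extra_tapes N).+1 -> symbol (aux_symbol N) * direction})
    (ob : option bool)
    (t : {ffun 'I_(extra_tapes N).+1 -> tape (aux_symbol N)}) (w : word) :
    program q = Act acts ->
    (q', f, ob) \in acts [ffun i => read (t i)] ->
    step D (Config q t w)
      (Config q' [ffun i => write_move (f i) (t i)]
        (if ob is Some b then rcons w b else w))
| step_yes (q qy qn : state N) t w :
    program q = Query qy qn -> D w ->
    step D (Config q t w) (Config qy t [::])
| step_no (q qy qn : state N) t w :
    program q = Query qy qn -> ~ D w ->
    step D (Config q t w) (Config qn t [::]).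

(* [reaches N D x n c]: some computation of [N] on [x] with oracle [D] is in
   configuration [c] after exactly [n] steps. *)
Inductive reaches (N : machine) (D : language) (x : word) :
    nat -> config N -> Prop :=
| reaches0 : reaches D x 0 (init_config N x)
| reachesS n c c' : reaches D x n c -> step D c c' -> reaches D x n.+1 c'.

Definition halts_with (N : machine) (c : config N) (o : outcome) : Prop :=
  program (cfg_state c) = Halt o.

Definition is_NPTM (N : machine) : Prop :=
  (forall D x n (c : config N), reaches D x n c ->
     (forall c', ~ step D c c') -> exists o, halts_with c o) /\
  exists p : {poly nat}, forall D x n (c : config N),
    reaches D x n c -> n <= p.[size x]%R.

Definition out (N : machine) (D : language) (x : word) : set outcome :=
  [set o | exists n (c : config N), reaches D x n c /\ halts_with c o].

Definition lang_of (N : machine) (D : language) : language :=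
  [set x | out N D x Acc].

Definition underproductive (N : machine) (D : language) : Prop :=
  forall x, ~ ([set Acc; Rej] `<=` out N D x).

Definition overproductive (N : machine) (D : language) : Prop :=
  forall x, out N D x <> [set Quest].

Definition robustly_underproductive (N : machine) : Prop :=
  forall D, underproductive N D.

Definition robustly_overproductive (N : machine) : Prop :=
  forall D, overproductive N D.

Definition SN_reduces_via (N : machine) (A B : language) : Prop :=
  [/\ is_NPTM N, overproductive N B, underproductive N B & A = lang_of N B].

Definition le_SN (A B : language) : Prop :=
  exists N, SN_reduces_via N A B.

Definition le_U (A B : language) : Prop :=
  exists N, SN_reduces_via N A B /\ robustly_underproductive N.

Definition le_O (A B : language) : Prop :=
  exists N, SN_reduces_via N A B /\ robustly_overproductive N.

(* Main.v *)
Require Import Defs.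
From HB Require Import structures.
From mathcomp Require Import all_boot all_order all_algebra.
From mathcomp Require Import boolp classical_sets.
From mathcomp Require Import zify.

(* Words of length n are the vertices of the de Bruijn graph, and words of
   length n+1 its edges. An oracle selects some of the edges; a vertex other
   than 0..0 is violated if it has an odd number of selected edges, and 0..0 is
   violated if it has an even number. Every edge has two ends, so the number of
   violated vertices is odd. Hence a machine that guesses a vertex of length
   |x|, queries its four edges, and, if the vertex is violated, accepts or
   rejects according to its last bit, is robustly overproductive. It is
   underproductive if exactly one vertex of each length is violated.

   Suppose a robustly underproductive M computes the same language on all
   oracles Z with a unique violated vertex. Toggling the edges of a walk from v
   to u moves the unique violation from v to u. If v ends in 1 and u in 0, then M
   accepts with Z and rejects with the toggled Z', each time with a certificate
   of polynomially many queries. The walk shifts in the bits of u one by one, so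
   its edges contain half of v at first and half of u later. From the point of
   view of Z the word u is random, and from the point of view of Z' the word v
   is; by counting, some Z, v, u are such that no edge of the walk is in both
   certificates. Then the certificates are compatible, and an oracle extending
   both makes M accept and reject. Diagonalising over the countably many
   machines at sparse lengths gives Y. *)

Set Implicit Arguments.
Unset Strict Implicit.
Unset Printing Implicit Defensive.

(** * Parity on the de Bruijn graph *)

Fixpoint xor_words (n : nat) (f : word -> bool) : bool :=
  if n is m.+1 then
    xor_words m (fun w => f (false :: w)) (+) xor_words m (fun w => f (true :: w))
  else f [::].

Lemma eq_xor_words n f g : f =1 g -> xor_words n f = xor_words n g.
Proof. by elim: n f g => [|n IHn] f g fg /=; rewrite ?fg //; congr addb; apply: IHn => w. Qed.

Lemma xor_wordsD n f g :
  xor_words n (fun w => f w (+) g w) = xor_words n f (+) xor_words n g.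
Proof. by elim: n f g => [//|n IHn] f g /=; rewrite !IHn addbACA. Qed.

Lemma xor_words0 n : xor_words n (fun=> false) = false.
Proof. by elim: n => [//|n IHn] /=; rewrite IHn. Qed.

(** The recursion splits off the first bit; splitting off the last one as well lets a sum over all
    edges be grouped by either end. *)
Lemma xor_words_rcons n f :
  xor_words n.+1 f =
  xor_words n (fun w => f (rcons w false)) (+) xor_words n (fun w => f (rcons w true)).
Proof.
elim: n f => [//|n IHn] f.
transitivity (xor_words n.+1 (fun w => f (false :: w)) (+)
              xor_words n.+1 (fun w => f (true :: w))); first by [].
by rewrite (IHn (fun w => f (false :: w))) (IHn (fun w => f (true :: w))) /= addbACA.
Qed.

Lemma xor_words_ex n f : xor_words n f -> exists2 w, size w = n & f w.
Proof.
elim: n f => [|n IHn] f /=; first by exists [::].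
case f0: (xor_words n _) => /= f1.
  by have [w <- fw] := IHn _ f0; exists (false :: w).
by have [w <- fw] := IHn _ f1; exists (true :: w).
Qed.

(** A loop, which exists only at a constant word, occurs twice in this sum and cancels. *)
Definition boundary (y : word -> bool) (v : word) : bool :=
  y (rcons v false) (+) y (rcons v true) (+) y (false :: v) (+) y (true :: v).

Definition violated (y : word -> bool) (v : word) : bool :=
  all negb v (+) boundary y v.

(** Summed over all vertices, the two [rcons] terms and the two cons terms each give the sum of [y]
    over all edges, so they cancel. What remains is the 1 contributed by 0..0. *)
Lemma exists_violated y n : exists2 v, size v = n & violated y v.
Proof.
apply: xor_words_ex.
rewrite (eq_xor_words _ (g := fun v => all negb v (+)
  ((y (rcons v false) (+) y (rcons v true)) (+) (y (false :: v) (+) y (true :: v))))).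
  rewrite !xor_wordsD -xor_words_rcons addbb addbF.
  by elim: n => [//|n IHn] /=; rewrite {}IHn xor_words0.
by move=> v; rewrite /violated /boundary !addbA.
Qed.

Lemma boundaryD y z v : boundary (fun w => y w (+) z w) v = boundary y v (+) boundary z v.
Proof. rewrite /boundary; move: (y (rcons v false)) (z (rcons v false)) (y (rcons v true)).
move: (z (rcons v true)) (y (false :: v)) (z (false :: v)) (y (true :: v)) (z (true :: v)).
by do 8!case. Qed.

Lemma eq_boundary n y z v : size v = n ->
  (forall w, size w = n.+1 -> y w = z w) -> boundary y v = boundary z v.
Proof. by move=> <- yz; rewrite /boundary !yz ?size_rcons. Qed.

Lemma eq_violated n y z v : size v = n ->
  (forall w, size w = n.+1 -> y w = z w) -> violated y v = violated z v.
Proof. by move=> sv /(eq_boundary sv) yz; rewrite /violated yz. Qed.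

Lemma boundary_edge n e w : size e = n.+1 -> size w = n ->
  boundary (fun e' => e' == e) w = (w == take n e) (+) (w == behead e).
Proof.
move=> se sw; rewrite /boundary -addbA; congr addb.
  case/lastP: e se => [//|e b]; rewrite size_rcons => -[<-].
  rewrite -(cats1 e) take_size_cat // cats1 !eqseq_rcons.
  by case: b; case: eqP.
by case: e se => [//|b e] _; rewrite !eqseq_cons /=; case: b; case: (w == e).
Qed.

(** * Walks, and moving the unique violation *)

Definition window n (s : word) i : word := take n.+1 (drop i s).

(** Parity of the number of passes through [e] in the first [k] steps of the walk spelled by [s]: an
    edge passed twice is toggled twice. *)
Fixpoint walk n (s : word) k (e : word) : bool :=
  if k is j.+1 then walk n s j e (+) (e == window n s j) else false.

(** Telescoping: the end of each edge of the walk is the beginning of the next, so only the two ends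
    of the walk survive. *)
Lemma boundary_walk n s k w : k + n <= size s -> size w = n ->
  boundary (walk n s k) w = (w == take n s) (+) (w == take n (drop k s)).
Proof.
move=> le_kn sw; elim: k le_kn => [|k IHk] le_kn; first by rewrite drop0 addbb.
rewrite (boundaryD (walk n s k)) IHk ?(boundary_edge _ sw); try lia; last first.
  by rewrite /window size_take_min size_drop; move: (size s) le_kn => sz; lia.
rewrite -addbA; congr addb; rewrite addbA.
rewrite /window take_takel // addbb /=.
suff -> : behead (take n.+1 (drop k s)) = take n (drop k.+1 s) by [].
by rewrite -[k.+1]add1n -drop_drop; case: (drop k s) => //= *; rewrite drop0.
Qed.

Lemma walk_window n s k e : walk n s k e -> exists2 i, i < k & e = window n s i.
Proof.
elim: k => [//|k IHk] /=; case: (e =P window n s k) => [-> _|_]; first by exists k.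
by rewrite addbF => /IHk[i ltik ->]; exists i => //; apply: ltnW.
Qed.

(** A finite type, so that the oracles on one length can be counted. *)
Definition edges n := {ffun n.+1.-tuple bool -> bool}.

Definition edge_pred n (Z : edges n) (w : word) : bool := oapp Z false (insub w).

Definition uniquely_violated n (y : word -> bool) v :=
  forall w, size w = n -> violated y w = (w == v).

Definition uviol n (Z : edges n) (v : word) : bool :=
  [forall w : n.-tuple bool, violated (edge_pred Z) w == (tval w == v)].

Lemma uviolP n (Z : edges n) v :
  reflect (uniquely_violated n (edge_pred Z) v) (uviol Z v).
Proof.
apply: (iffP forallP) => [H w sw|H w]; last by rewrite H ?size_tuple.
by have /eqP := H (Tuple (introT eqP sw)).
Qed.

(** For [v] and [u] of length [n], the word [v ++ u] spells a walk of [n] steps from [v] to [u]. *)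
Definition shift n (v u : word) (Z : edges n) : edges n :=
  [ffun e => Z e (+) walk n (v ++ u) n e].

Lemma shiftK n v u : involutive (@shift n v u).
Proof. by move=> Z; apply/ffunP => e; rewrite !ffunE addbK. Qed.

Lemma edge_pred_shift n v u (Z : edges n) w : size w = n.+1 ->
  edge_pred (shift v u Z) w = edge_pred Z w (+) walk n (v ++ u) n w.
Proof.
move=> sw; rewrite /edge_pred; case: insubP => [t _ <-|]; last by rewrite sw eqxx.
by rewrite /= ffunE.
Qed.

Lemma uviol_shift n v u (Z : edges n) : size v = n -> size u = n ->
  uviol (shift v u Z) u = uviol Z v.
Proof.
move=> sv su; apply: eq_forallb => w; have sw := size_tuple w.
rewrite /violated (eq_boundary sw (edge_pred_shift v u Z)) boundaryD.
rewrite boundary_walk // ?size_cat ?sv ?su //.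
rewrite take_size_cat // drop_size_cat // take_oversize ?su //.
by case: (all _ _); case: (boundary _ _); case: (tval w == v); case: (tval w == u).
Qed.

(** The involution [shift v u] matches the two sets. *)
Lemma card_uviol n v u : size v = n -> size u = n ->
  #|[pred Z : edges n | uviol Z v]| = #|[pred Z : edges n | uviol Z u]|.
Proof.
move=> sv su; rewrite -!sum1_card [RHS](reindex_inj (inv_inj (@shiftK n v u))).
by apply: eq_bigl => Z; rewrite !inE uviol_shift.
Qed.

(** With no edge selected, 0..0 is the only violated vertex; the count does not depend on the
    vertex. *)
Lemma card_uviol_gt0 n v : size v = n -> 0 < #|[pred Z : edges n | uviol Z v]|.
Proof.
move=> sv; rewrite (card_uviol sv (size_nseq n false)).
apply/card_gt0P; exists [ffun=> false]; rewrite inE; apply/uviolP => w sw.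
have e0 e : edge_pred ([ffun=> false] : edges n) e = false.
  by rewrite /edge_pred; case: insub => //= t; rewrite ffunE.
rewrite /violated /boundary !e0 addbF -sw.
by elim: w {sw} => [//|[] w IHw] /=; rewrite // IHw eqseq_cons.
Qed.

(** * Counting certificates that meet a walk *)

Lemma sum_mem_le l (S : seq word) : \sum_(b : l.-tuple bool) (val b \in S) <= size S.
Proof.
rewrite -big_mkcond sum1_card cardE -(size_map val); apply: uniq_leq_size.
  by rewrite (map_inj_uniq val_inj) enum_uniq.
by move=> x /mapP[b]; rewrite mem_enum => bS ->.
Qed.

Definition slices n l (S : seq word) : seq word :=
  [seq take l (drop j e) | e <- S, j <- iota 0 n].

(** The last bits 1 of [hi] and 0 of [lo] give opposite verdicts. The walk between them spells 0^l a
    1 b 0^(l+1), where each window of length 2l+2 has room for a whole half. *)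
Definition hi l (a : word) : word := nseq l false ++ rcons a true.
Definition lo l (b : word) : word := b ++ nseq l.+1 false.

Lemma size_hi l (a : l.-tuple bool) : size (hi l a) = l.*2.+1.
Proof. by rewrite size_cat size_nseq size_rcons size_tuple -addnn addnS. Qed.
Lemma size_lo l (b : l.-tuple bool) : size (lo l b) = l.*2.+1.
Proof. by rewrite size_cat size_nseq size_tuple -addnn addnS. Qed.

(* The first half of the windows on the way from [hi a] to [lo b] contain [a],
   and the second half contain [b]. *)
Lemma walk_slice l (a b : l.-tuple bool) (S T : seq word) (e : word) :
  e \in S -> e \in T -> walk l.*2.+1 (hi l a ++ lo l b) l.*2.+1 e ->
  (val b \in slices l.*2.+2 l S) || (val a \in slices l.*2.+2 l T).
Proof.
move=> eS eT /walk_window[i lti def_e].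
(* A factor at position [i + j] of the spelled word sits at offset [j] of window [i]; the offset is
   [l - i] for [a] and [2l+1 - i] for [b]. *)
have slice p s q j : hi l a ++ lo l b = p ++ s ++ q -> size p = i + j ->
    size s = l -> j <= l.+2 -> take l (drop j e) = s.
  move=> def_s sp ss lej; rewrite def_e /window take_drop take_takel; last by lia.
  by rewrite -take_drop drop_drop def_s addnC -sp drop_size_cat // -ss take_size_cat.
have [le_il|lt_li] := leqP i l; apply/orP; [right|left].
  apply/allpairsP; exists (e, l - i); split=> //; first by rewrite mem_iota /=; lia.
  rewrite /=; apply/esym; apply: (slice (nseq l false) _ (true :: lo l b));
    rewrite ?size_nseq ?size_tuple //; try lia.
  by rewrite /hi -cats1 -!catA.
apply/allpairsP; exists (e, l.*2.+1 - i); split=> //; first by rewrite mem_iota /=; lia.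
rewrite /=; apply/esym; apply: (slice (hi l a) _ (nseq l.+1 false));
  rewrite ?size_hi ?size_tuple //; lia.
Qed.

(** If there is no such pair, each triple of [a], [b] and [Z] with unique violation [hi l a] has [b]
    among the slices of [S Z] or [a] among those of [T] at the shifted oracle. Each list has at most
    k(2l+2) slices, too few to account for all triples. *)
Lemma unseparated_pair l k (S T : edges l.*2.+1 -> seq word) :
    (forall Z, size (S Z) <= k) -> (forall Z, size (T Z) <= k) ->
    2 * (k * l.*2.+2) < 2 ^ l ->
  exists (Z Z' : edges l.*2.+1) (a b : l.-tuple bool),
    [/\ uviol Z (hi l a), uviol Z' (lo l b) &
        forall e : word, e \in S Z -> e \in T Z' -> edge_pred Z e = edge_pred Z' e].
Proof.
set n := l.*2.+1 => leS leT lt_k; apply: contrapT => noP.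
pose A : finType := l.-tuple bool; pose sh (a b : A) (Z : edges n) := shift (hi l a) (lo l b) Z.
pose F Z := slices n.+1 l (S Z); pose G Z := slices n.+1 l (T Z).
have [szh szl] : (forall a : A, size (hi l a) = n) /\ (forall b : A, size (lo l b) = n).
  by split=> ?; rewrite ?size_hi ?size_lo.
(* Otherwise [Z] and its shift form the wanted pair: they differ only on the walk, and [walk_slice]
   excludes a common word there. *)
have FG (a b : A) Z : uviol Z (hi l a) -> (val b \in F Z) || (val a \in G (sh a b Z)).
  move=> uZ; apply: contrapT => /negP; rewrite negb_or => /andP[nF nG]; apply: noP.
  exists Z, (sh a b Z), a, b; split; rewrite ?uviol_shift //.
  move=> e eS eT; have [se|/negPf se] := boolP (size e == n.+1); last first.
    by rewrite /edge_pred !insubF.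
  rewrite edge_pred_shift; last exact/eqP.
  case W: (walk _ _ _ e); rewrite ?addbF //.
  by have := walk_slice eS eT W; rewrite -/n (negbTE nF) (negbTE nG).
pose z : A := [tuple of nseq l false]; pose N := #|[pred Z : edges n | uviol Z (hi l z)]|.
have Nhi (a : A) : #|[pred Z : edges n | uviol Z (hi l a)]| = N.
  by apply: card_uviol; rewrite ?szh ?szl.
have Nlo (b : A) : #|[pred Z : edges n | uviol Z (lo l b)]| = N.
  by apply: card_uviol; rewrite ?szh ?szl.
have N_gt0 : 0 < N by apply: card_uviol_gt0; rewrite szh.
have szF (H : edges n -> seq word) Z : (forall Z, size (H Z) <= k) ->
    \sum_(b : A) (val b \in slices n.+1 l (H Z)) <= k * n.+1.
  move=> leH; apply: leq_trans (sum_mem_le _ _) _.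
  by rewrite size_allpairs size_iota leq_mul2r leH orbT.
have cardA : #|{: A}| = 2 ^ l by rewrite card_tuple card_bool.
have: \sum_(a : A) \sum_(b : A) N <=
      \sum_(a : A) \sum_(b : A) \sum_(Z | uviol Z (hi l a)) (val b \in F Z) +
      \sum_(a : A) \sum_(b : A) \sum_(Z | uviol Z (hi l a)) (val a \in G (sh a b Z)).
  rewrite -big_split leq_sum // => a _; rewrite -big_split leq_sum // => b _.
  rewrite -(Nhi a) -sum1_card -big_split leq_sum // => Z uZ.
  by have := FG a b Z uZ; rewrite /=; case: (_ \in F Z); case: (_ \in G _).
have bound1 : \sum_(a : A) \sum_(b : A) \sum_(Z | uviol Z (hi l a)) (val b \in F Z)
    <= \sum_(a : A) N * (k * n.+1).
  apply: leq_sum => a _; rewrite exchange_big -(Nhi a) -sum_nat_const leq_sum // => Z _.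
  exact: szF.
have bound2 : \sum_(a : A) \sum_(b : A) \sum_(Z | uviol Z (hi l a)) (val a \in G (sh a b Z))
    <= \sum_(b : A) N * (k * n.+1).
  rewrite exchange_big; apply: leq_sum => b _.
  (* After reindexing by the shift, the oracles range over a set that depends on [b] alone, so [a]
     can be summed first. *)
  rewrite (eq_bigr (fun a => \sum_(Z | uviol Z (lo l b)) (val a \in G Z))); last first.
    move=> a _; rewrite [RHS](reindex_inj (inv_inj (@shiftK n (hi l a) (lo l b)))).
    by apply: eq_bigl => Z; rewrite uviol_shift.
  rewrite exchange_big -(Nlo b) -sum_nat_const leq_sum // => Z _.
  exact: szF.
(* Cancelling [2 ^ l * N] leaves 2^l <= 2k(n+1), against the hypothesis. *)
move=> /leq_trans/(_ (leq_add bound1 bound2)).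
rewrite !sum_nat_const cardA -mulnDr leq_pmul2l ?expn_gt0 // addnn -mul2n.
rewrite mulnCA [2 ^ l * N]mulnC leq_pmul2l // leqNgt.
by rewrite lt_k.
Qed.

(** * The machine that looks for a violated vertex *)

Inductive phase :=
| Guess
| Back of bool & bool
| Fwd of bool & bool
| Ask of bool & bool
| Done.

Definition phase_code (s : phase) : option (option ('I_3 * (bool * bool))) :=
  match s with
  | Guess => None
  | Done => Some None
  | Back f b => Some (Some (inord 0, (f, b)))
  | Fwd f b => Some (Some (inord 1, (f, b)))
  | Ask f b => Some (Some (inord 2, (f, b)))
  end.

Definition phase_decode (o : option (option ('I_3 * (bool * bool)))) : phase :=
  match o with
  | None => Guess
  | Some None => Done
  | Some (Some (i, (f, b))) =>
      match val i with 0 => Back f b | 1 => Fwd f b | _ => Ask f b end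
  end.

Lemma phase_codeK : cancel phase_code phase_decode.
Proof. by case=> //= f b; rewrite inordK. Qed.

HB.instance Definition _ := Finite.copy phase (can_type phase_codeK).

(* An edge joins the two words obtained by deleting its first and its last bit. *)
Definition edge (f b : bool) (v : word) : word := if f then b :: v else rcons v b.

Definition next_phase (f b : bool) : phase :=
  match f, b with
  | false, false => Back false true
  | false, true => Back true false
  | true, false => Back true true
  | true, true => Done
  end.

(* Current phase, parity accumulated so far, last bit of the guessed word. *)
Definition finder_state : finType := (phase * bool * bool)%type.

Notation finder_action := (action finder_state void 1).

Definition act1 (q : finder_state) (a : symbol void) (d : direction) (o : option bool) :
    finder_action := (q, [ffun=> (a, d)], o).

(** The guess overwrites the input, whose end marks the length. Here [p] records whether all bits so
    far are 0, the term [all negb v] of [violated]. *)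
Definition guess_acts (p l : bool) (a : symbol void) : {set finder_action} :=
  if a is Some _ then
    [set act1 (Guess, p && ~~ b, b) (Some (inl b)) GoRight None | b in [set: bool]]%SET
  else [set act1 (Back false false, p, l) None GoLeft None]%SET.

(** The oracle tape is append-only, so a bit to be prepended is written here, before the copy;
    [fwd_act] writes an appended bit after it. *)
Definition back_act (f b p l : bool) (a : symbol void) : finder_action :=
  if a is Some _ then act1 (Back f b, p, l) a GoLeft None
  else act1 (Fwd f b, p, l) None GoRight (if f then Some b else None).

Definition fwd_act (f b p l : bool) (a : symbol void) : finder_action :=
  if a is Some c then
    act1 (Fwd f b, p, l) a GoRight (if c is inl c then Some c else None)
  else act1 (Ask f b, p, l) None GoLeft (if f then None else Some b).

Definition finder_program (q : finder_state) : instruction finder_state void 1 :=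
  let: (s, p, l) := q in
  match s with
  | Guess => Act (fun r => guess_acts p l (r ord0))
  | Back f b => Act (fun r => [set back_act f b p l (r ord0)]%SET)
  | Fwd f b => Act (fun r => [set fwd_act f b p l (r ord0)]%SET)
  | Ask f b => Query (next_phase f b, ~~ p, l) (next_phase f b, p, l)
  | Done => Halt (if p then if l then Acc else Rej else Quest)
  end.

Definition finder : machine :=
  @Machine finder_state void 0 (Guess, true, false) finder_program.

Definition conf (q : finder_state) (t : tape void) (w : word) : config finder :=
  @Config finder q [ffun=> t] w.

(** * Single steps and the runs of [finder] *)

Lemma step_ActE (N : machine) D (q : state N) t w c' acts : program q = Act acts ->
  step D (Config q t w) c' <->
  exists q' f ob, (q', f, ob) \in acts [ffun i => read (t i)] /\
    c' = Config q' [ffun i => write_move (f i) (t i)]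
           (if ob is Some b then rcons w b else w).
Proof.
move=> q_acts; split=> [|[q' [f [ob [inA ->]]]]]; last exact: step_act q_acts inA.
move Ec: (Config q t w) => c s.
case: s Ec => [q1 q' acts1 f ob t1 w1 q1P inA|q1 qy qn t1 w1 q1P _|q1 qy qn t1 w1 q1P _]
  [Eq Et Ew]; subst; move: q1P; rewrite q_acts // => -[Ea]; subst.
by exists q', f, ob.
Qed.

Lemma step_QueryE (N : machine) D (q : state N) t w c' qy qn : program q = Query qy qn ->
  step D (Config q t w) c' <-> c' = Config (if `[< D w >] then qy else qn) t [::].
Proof.
move=> q_qry; split=> [|->]; last first.
  by case: asboolP => Dw; [apply: step_yes q_qry Dw | apply: step_no q_qry Dw].
move Ec: (Config q t w) => c s.
case: s Ec => [q1 q' acts1 f ob t1 w1 q1P _|q1 qy1 qn1 t1 w1 q1P Dw|q1 qy1 qn1 t1 w1 q1P Dw]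
  [Eq Et Ew]; subst; move: q1P; rewrite q_qry // => -[Ey En]; subst.
  by rewrite asboolT.
by rewrite asboolF.
Qed.

Lemma step_HaltE (N : machine) D (q : state N) t w c' o : program q = Halt o ->
  ~ step D (Config q t w) c'.
Proof.
move=> q_halt; move Ec: (Config q t w) => c s.
by case: s Ec => [q1 q' acts1 f ob t1 w1 q1P _|q1 qy1 qn1 t1 w1 q1P Dw|q1 qy1 qn1 t1 w1 q1P Dw]
  [Eq Et Ew]; subst; move: q1P; rewrite q_halt.
Qed.

Lemma step_act1E D q t w c a d q' o acts :
  finder_program q = Act acts -> acts [ffun=> read t] = [set act1 q' a d o]%SET ->
  step D (conf q t w) c <->
  c = conf q' (write_move (a, d) t) (if o is Some b then rcons w b else w).
Proof.
move=> qP aE; rewrite (@step_ActE finder D q _ w c acts qP).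
have -> : [ffun i => read ([ffun=> t] i)] = [ffun=> read t] :> {ffun 'I_1 -> symbol void}.
  by apply/ffunP => i; rewrite !ffunE.
rewrite aE; split=> [[q1 [f [ob []]]]|->].
  rewrite inE => /eqP[-> -> ->] ->; congr Config.
  by apply/ffunP => i; rewrite !ffunE.
exists q', [ffun=> (a, d)], o; split; first by rewrite inE.
by congr Config; apply/ffunP => i; rewrite !ffunE.
Qed.

Definition oracle_pred (D : language) (w : word) : bool := `[< D w >].

Definition bits (v : word) : seq (symbol void) := [seq Some (inl b) | b <- v].

(** The value of [p] when round [(f, b)] begins: the initial term plus the answers of the earlier
    rounds, in the order of [next_phase]. *)
Definition parity_before (y : word -> bool) (f b : bool) (v : word) : bool :=
  all negb v (+)
  (f || b) && y (rcons v false) (+) f && y (rcons v true) (+) (f && b) && y (false :: v).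

(* Steps left in phase [Ask f b], each later query costing [n.*2.+3] steps. *)
Definition ask_cost (n : nat) (f b : bool) : nat :=
  (if f then ~~ b : nat else 2 + ~~ b) * n.*2.+3 + 1.

(** Run invariant: the guess is, or can still become, [v], and exactly [k] steps remain. The
    counters [i] and [j] are the numbers of explicit blanks at the two ends of the tape. *)
Inductive track (y : word -> bool) (v : word) : nat -> config finder -> Prop :=
| track_guess pre post s k t :
    v = pre ++ post -> size s = size post ->
    k = size post + (size v).*2 + 3 + ask_cost (size v) false false ->
    t = Tape (rev (bits pre)) (bits s) ->
    track y v k (conf (Guess, all negb pre, last false pre) t [::])
| track_back f b pre post i j k t :
    v = pre ++ post -> k = size pre + size v + 2 + ask_cost (size v) f b ->
    t = Tape (behead (rev (bits pre) ++ nseq i None))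
          (head None (rev (bits pre) ++ nseq i None) :: bits post ++ nseq j None) ->
    track y v k (conf (Back f b, parity_before y f b v, last false v) t [::])
| track_fwd f b pre post i j k t w :
    v = pre ++ post -> k = size post + 1 + ask_cost (size v) f b ->
    t = Tape (rev (bits pre) ++ nseq i None) (bits post ++ nseq j None) ->
    w = (if f then b :: pre else pre) ->
    track y v k (conf (Fwd f b, parity_before y f b v, last false v) t w)
| track_ask f b i j k t :
    k = ask_cost (size v) f b ->
    t = Tape (behead (rev (bits v) ++ nseq i None))
          (head None (rev (bits v) ++ nseq i None) :: nseq j None) ->
    track y v k (conf (Ask f b, parity_before y f b v, last false v) t (edge f b v))
| track_done t w : track y v 0 (conf (Done, violated y v, last false v) t w).

Lemma rev_bits_rcons v b : rev (bits (rcons v b)) = Some (inl b) :: rev (bits v).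
Proof. by rewrite /bits map_rcons rev_rcons. Qed.

Lemma behead_blanks j : None :: behead (nseq j None) = nseq j.-1.+1 None :> seq (symbol void).
Proof. by case: j. Qed.

Lemma track_det D v k c c1 :
    (forall c', step D c c' <-> c' = c1) -> track (oracle_pred D) v k c1 ->
  (exists2 c', step D c c' & track (oracle_pred D) v k c') /\
  (forall c', step D c c' -> exists2 v', size v' = size v & track (oracle_pred D) v' k c').
Proof.
move=> stepE tr; split; first by exists c1 => //; apply/stepE.
by move=> c' /stepE ->; exists v.
Qed.

(** The first half steers a run to a prescribed [v]. In the second, [v'] may differ from [v],
    because a guessing step is free to choose another bit. *)
Lemma track_step D v k c : track (oracle_pred D) v k.+1 c ->
  (exists2 c', step D c c' & track (oracle_pred D) v k c') /\
  (forall c', step D c c' -> exists2 v', size v' = size v & track (oracle_pred D) v' k c').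
Proof.
set y := oracle_pred D; move Ek: k.+1 => k1 tr.
case: tr Ek => [pre post s k2 t def_v szs -> ->|f b pre post i j k2 t def_v -> ->
               |f b pre post i j k2 t w def_v -> -> ->|f b i j k2 t -> ->|//] Ek.
- case: s post szs def_v Ek => [|a s] [|b post] //= => [_|[szs]] def_v Ek.
    rewrite cats0 in def_v; subst pre.
    apply: (@track_det _ _ _ _ (conf (Back false false, _, _) _ _)).
      move=> c'; apply: (@step_act1E _ _ _ _ _ _ _ _ _ (fun r => guess_acts _ _ (r ord0))) => //.
      by rewrite ffunE.
    rewrite -[all negb v](_ : parity_before y false false v = _); last first.
      by rewrite /parity_before !addbF.
    apply: (track_back _ (pre := v) (post := [::]) (i := 0) (j := 1)).
    - by rewrite cats0.
    - by move: (size v) Ek => n /=; lia.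
    - by rewrite cats0.
  have stepE d : step D (conf (Guess, all negb pre, last false pre)
        {| leftward := rev (bits pre); rightward := bits (a :: s) |} [::]) d <->
      exists b, d = conf (Guess, all negb (rcons pre b), b)
        (Tape (Some (inl b) :: rev (bits pre)) (bits s)) [::].
    rewrite (@step_ActE finder D _ _ _ _ (fun r => guess_acts _ _ (r ord0))) //.
    rewrite !ffunE /=; split=> [[q' [g [ob [/imsetP[b' _ [-> -> ->]] ->]]]]|[b' ->]].
      exists b'; rewrite all_rcons andbC.
      by congr Config; apply/ffunP => i; rewrite !ffunE.
    exists (Guess, all negb pre && ~~ b', b'), [ffun=> (Some (inl b'), GoRight)], None.
    split; first by apply/imsetP; exists b'.
    by rewrite all_rcons andbC; congr Config; apply/ffunP => i; rewrite !ffunE.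
  have tr b' : track y (pre ++ b' :: post) k (conf (Guess, all negb (rcons pre b'), b')
        (Tape (Some (inl b') :: rev (bits pre)) (bits s)) [::]).
    rewrite -[X in (Guess, _, X)](last_rcons false pre).
    apply: (track_guess _ (post := post) (s := s)) => //; rewrite ?rev_bits_rcons ?cat_rcons //.
    by move: Ek; rewrite def_v !size_cat /=; lia.
  split.
    by eexists; [apply/stepE; exists b; reflexivity|rewrite def_v].
  move=> d /stepE[b' ->]; exists (pre ++ b' :: post) => //.
  by rewrite def_v !size_cat.
- have [Ep|[pre' [b' Ep]]] : pre = [::] \/ exists pre' b', pre = rcons pre' b'.
    by case/lastP: (pre) => [|p x]; [left|right; exists p, x].
  + subst pre; rewrite /= in def_v; subst v.
    apply: (@track_det _ _ _ _ (conf (Fwd f b, _, _) _ _)).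
      move=> c'; apply: (@step_act1E _ _ _ _ _ _ _ _ _
        (fun r => [set back_act f b _ _ (r ord0)]%SET)) => //.
      by rewrite ffunE /=; case: (i).
    (* Rewriting the scanned blank makes it explicit if it was not, hence [i.-1.+1]. *)
    apply: (track_fwd _ (pre := [::]) (post := post) (i := i.-1.+1) (j := j)) => //.
    - by move: (size post) Ek => n /=; lia.
    - by rewrite /write_move /= behead_blanks.
    - by case: f Ek.
  + subst pre; apply: (@track_det _ _ _ _ (conf (Back f b, _, _) _ _)).
      move=> c'; apply: (@step_act1E _ _ _ _ _ _ _ _ _
        (fun r => [set back_act f b _ _ (r ord0)]%SET)) => //.
      by rewrite ffunE rev_bits_rcons.
    apply: (track_back _ (pre := pre') (post := b' :: post) (i := i) (j := j)) => //.
    - by rewrite -cat_rcons.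
    - by move: Ek; rewrite size_rcons; lia.
    - by rewrite rev_bits_rcons.
- case: post def_v Ek => [|a post] def_v Ek.
    rewrite cats0 in def_v; subst pre.
    apply: (@track_det _ _ _ _ (conf (Ask f b, _, _) _ _)).
      move=> c'; apply: (@step_act1E _ _ _ _ _ _ _ _ _
        (fun r => [set fwd_act f b _ _ (r ord0)]%SET)) => //.
      by rewrite ffunE /=; case: (j).
    rewrite [X in conf _ _ X](_ : _ = edge f b v); last by case: f Ek.
    apply: (track_ask _ (i := i) (j := j.-1.+1)) => //.
    - by move: Ek => /=; lia.
    - by rewrite /write_move /= behead_blanks.
  apply: (@track_det _ _ _ _ (conf (Fwd f b, _, _) _ _)).
    move=> c'; apply: (@step_act1E _ _ _ _ _ _ _ _ _
        (fun r => [set fwd_act f b _ _ (r ord0)]%SET)) => //.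
    by rewrite ffunE.
  apply: (track_fwd _ (pre := rcons pre a) (post := post) (i := i) (j := j)) => //.
  - by rewrite cat_rcons.
  - by move: Ek => /=; lia.
  - by rewrite rev_bits_rcons.
  - by case: f Ek.
- apply: track_det => [c'|].
    exact: (@step_QueryE finder D (Ask f b, _, _)).
  rewrite -/(oracle_pred D _) -/y.
  have -> p l : (if y (edge f b v) then (next_phase f b, ~~ p, l) else (next_phase f b, p, l))
      = (next_phase f b, p (+) y (edge f b v), l) by case: y; case: p.
  move: Ek; case: f; case: b; rewrite /ask_cost /= => Ek.
  - have -> : k = 0 by lia.
    rewrite [_ (+) y _](_ : _ = violated y v); first exact: track_done.
    by rewrite /parity_before /violated /boundary /= !addbA.
  - rewrite [_ (+) y _](_ : _ = parity_before y true true v).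
      by apply: (track_back _ (pre := v) (post := [::])); rewrite ?cats0 // /ask_cost; lia.
    by rewrite /parity_before /= !addbF.
  - rewrite [_ (+) y _](_ : _ = parity_before y true false v).
      by apply: (track_back _ (pre := v) (post := [::])); rewrite ?cats0 // /ask_cost; lia.
    by rewrite /parity_before /= !addbF.
  - rewrite [_ (+) y _](_ : _ = parity_before y false true v).
      by apply: (track_back _ (pre := v) (post := [::])); rewrite ?cats0 // /ask_cost; lia.
    by rewrite /parity_before /= !addbF.
Qed.

(** The sum of n+1 steps to guess and turn, four round trips of 2n+2 steps, and four queries. *)
Definition finder_time n := 9 * n + 13.

Lemma track0 y v c : track y v 0 c ->
  exists t w, c = conf (Done, violated y v, last false v) t w.
Proof.
move Ek: 0 => k tr; case: tr Ek => [pre post s k2 t _ _ ->|f b pre post i j k2 t _ ->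
  |f b pre post i j k2 t w _ ->|f b i j k2 t ->|t w] Ek; try by exists t, w.
all: by move: Ek; rewrite /ask_cost; lia.
Qed.

Lemma finder_init y x v : size v = size x ->
  track y v (finder_time (size x)) (init_config finder x).
Proof.
move=> sv; have -> : init_config finder x =
    conf (Guess, all negb [::], last false [::]) (Tape [::] (bits x)) [::].
  by congr Config; apply/ffunP => i; rewrite !ffunE ord1 eqxx.
apply: (track_guess _ (pre := [::]) (post := v) (s := x)) => //.
by rewrite /finder_time /ask_cost /= sv; move: (size x) => n; lia.
Qed.

Lemma finder_sound D x n c : reaches D x n c -> exists v k,
  [/\ size v = size x, n + k = finder_time (size x) & track (oracle_pred D) v k c].
Proof.
elim=> [|{}n c1 c2 _ [v [[|k] [sv nk tr]]] s].
(* Nothing is guessed yet, so any word of the right length serves as [v]. *)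
- by exists x, (finder_time (size x)); split=> //; exact: finder_init.
- by case/track0: tr s => t [w ->] s; exfalso; apply: step_HaltE s.
have [_ /(_ _ s)[v' sv' tr']] := track_step tr.
by exists v', k; split=> //; rewrite ?sv' // addSnnS.
Qed.

Lemma finder_complete D x v : size v = size x ->
  exists n c, @reaches finder D x n c /\ track (oracle_pred D) v 0 c.
Proof.
move=> sv; suff H k : k <= finder_time (size x) -> exists n c,
    @reaches finder D x n c /\ track (oracle_pred D) v (finder_time (size x) - k) c.
  by have := H _ (leqnn _); rewrite subnn.
elim: k => [_|k IHk lt_k].
  by exists 0, (init_config finder x); rewrite subn0; split; [left|exact: finder_init].
have [n [c [re]]] := IHk (ltnW lt_k).
rewrite (_ : finder_time _ - k = (finder_time (size x) - k.+1).+1); last by lia.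
by move=> /track_step[[c' s tr] _]; exists n.+1, c'; split=> //; right with c.
Qed.

Definition verdict (y : word -> bool) (v : word) : outcome :=
  if violated y v then if last false v then Acc else Rej else Quest.

Lemma finder_outP D x o : out finder D x o <->
  exists2 v, size v = size x & o = verdict (oracle_pred D) v.
Proof.
split=> [[n [c [/finder_sound[v [[|k] [sv _ tr]]] co]]]|[v sv ->]].
- exists v => //; case/track0: tr co => t [w ->].
  by rewrite /halts_with /= => -[<-].
- case: (track_step tr) => -[c' s _] _.
  by case: c s co {tr} => q t w s co; case: (@step_HaltE finder _ _ _ _ _ _ co s).
- have [n [c [re /track0[t [w Ec]]]]] := finder_complete D sv.
  by exists n, c; split=> //; rewrite Ec.
Qed.

Lemma finder_NPTM : is_NPTM finder.
Proof.
split=> [D x n c /finder_sound[v [[|k] [_ _ tr]]] stuck|].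
- by have [t [w ->]] := track0 tr; eexists.
- by have [[c' /stuck]] := track_step tr.
exists ((9%N)%:P * 'X + (13%N)%:P)%R => D x n c /finder_sound[v [k [_ nk _]]].
rewrite !hornerE; apply: leq_trans (leq_addr k n) _; rewrite nk /finder_time.
exact: leqnn.
Qed.

Lemma finder_overproductive : robustly_overproductive finder.
Proof.
move=> D x outQ; have [v sv vv] := exists_violated (oracle_pred D) (size x).
have : out finder D x (verdict (oracle_pred D) v) by apply/finder_outP; exists v.
by rewrite outQ /verdict vv; case: last.
Qed.

(** * Certificates, and an enumeration of all machines *)

(** The certificate [S] lists the queries made. A step appends at most one bit to the oracle tape,
    so the bound on [cfg_query] carried along bounds their lengths. *)
Lemma reaches_certificate (N : machine) D x n (c : config N) : reaches D x n c ->
  size (cfg_query c) <= n /\ exists S : seq word, [/\ size S <= n,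
    forall w, w \in S -> size w <= n &
    forall D' : language, (forall w, w \in S -> D w <-> D' w) -> reaches D' x n c].
Proof.
elim=> [|{}n c1 c2 re [szq [S [szS szw agree]]] s].
  by split=> //; exists [::]; split=> // D' _; left.
case: s re szq agree => [q q' acts f ob t w qP inA|q qy qn t w qP Dw|q qy qn t w qP Dw]
  re szq agree.
- split; first by rewrite /=; case: ob inA => [b|] inA; rewrite ?size_rcons; [|apply: leqW].
  exists S; split=> [|w' /szw|D' /agree re']; [exact: leqW|exact: leqW|].
  by right with (Config q t w) => //; apply: step_act qP inA.
- split=> //; exists (w :: S); split=> // [w'|D' DD'].
    by rewrite inE => /predU1P[->|/szw]; [apply: leqW|apply: leqW].
  right with (Config q t w); first by apply: agree => w' w'S; apply: DD'; rewrite inE w'S orbT.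
  by apply: step_yes qP _; apply/DD' => //; rewrite mem_head.
- split=> //; exists (w :: S); split=> // [w'|D' DD'].
    by rewrite inE => /predU1P[->|/szw]; [apply: leqW|apply: leqW].
  right with (Config q t w); first by apply: agree => w' w'S; apply: DD'; rewrite inE w'S orbT.
  by apply: step_no qP _ => /DD' D'w; apply: Dw; apply: D'w; rewrite mem_head.
Qed.

Lemma out_certificate (N : machine) : is_NPTM N -> exists p : {poly nat},
  forall D x o, out N D x o -> exists S : seq word, [/\ size S <= p.[size x]%R,
    forall w, w \in S -> size w <= p.[size x]%R &
    forall D' : language, (forall w, w \in S -> D w <-> D' w) -> out N D' x o].
Proof.
move=> [_ [p le_p]]; exists p => D x o [n [c [re co]]].
have le_n := le_p _ _ _ _ re; have [_ [S [szS szw agree]]] := reaches_certificate re.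
exists S; split=> [|w /szw le_w|D' /agree re']; try exact: leq_trans le_n.
by exists n, c.
Qed.

(** * Renaming states and symbols, and codes of machines *)

Section MapMachine.

Variables (Q Q' G G' : finType) (k : nat) (q0 : Q) (q0' : Q').
Variables (prog : Q -> instruction Q G k.+1) (prog' : Q' -> instruction Q' G' k.+1).
Variables (fq : Q -> Q') (fg : G -> G').

Definition map_symbol (H H' : Type) (f : H -> H') (a : option (bool + H)) : option (bool + H') :=
  if a is Some y then Some (match y with inl b => inl b | inr g => inr (f g) end) else None.

Definition map_tape (t : tape G) : tape G' :=
  Tape (map (map_symbol fg) (leftward t)) (map (map_symbol fg) (rightward t)).

Definition map_writes (f : {ffun 'I_k.+1 -> symbol G * direction}) :
    {ffun 'I_k.+1 -> symbol G' * direction} :=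
  [ffun i => (map_symbol fg (f i).1, (f i).2)].

Definition map_reads (r : {ffun 'I_k.+1 -> symbol G}) : {ffun 'I_k.+1 -> symbol G'} :=
  [ffun i => map_symbol fg (r i)].

(** A one-way simulation, which yields an inclusion of outcomes; a renaming and its inverse together
    yield equality. *)
Definition simulates : Prop := forall q,
  match prog q with
  | Halt o => prog' (fq q) = Halt o
  | Query qy qn => prog' (fq q) = Query (fq qy) (fq qn)
  | Act acts => exists2 acts', prog' (fq q) = Act acts' &
      forall r q' f ob, (q', f, ob) \in acts r ->
        (fq q', map_writes f, ob) \in acts' (map_reads r)
  end.

Let N := @Machine Q G k q0 prog.
Let N' := @Machine Q' G' k q0' prog'.

Definition map_config (c : config N) : config N' :=
  @Config N' (fq (cfg_state c)) [ffun i => map_tape (cfg_tapes c i)] (cfg_query c).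

Lemma read_map_tape t : read (map_tape t) = map_symbol fg (read t).
Proof. by case: t => l []. Qed.

Lemma write_move_map_tape a d t :
  write_move (map_symbol fg a, d) (map_tape t) = map_tape (write_move (a, d) t).
Proof. by case: t => [[|b l] [|c r]]; case: d. Qed.

Hypothesis sim : simulates.

Lemma step_map D (c c' : config N) : step D c c' -> step D (map_config c) (map_config c').
Proof.
case=> [q q' acts f ob t w qP inA|q qy qn t w qP Dw|q qy qn t w qP Dw];
  have := sim q; rewrite /= in qP; rewrite qP => qP'.
- case: qP' => acts' qP' /(_ _ _ _ _ inA) inA'.
  rewrite /map_config /=.
  rewrite [X in step _ _ (Config _ X _)](_ : _ = [ffun i => write_move (map_writes f i)
     ([ffun i => map_tape (t i)] i)]); last first.
    apply/ffunP => i; rewrite /map_writes !ffunE.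
    by rewrite write_move_map_tape -surjective_pairing.
  apply: (@step_act N') qP' _.
  rewrite [X in acts' X](_ : _ = map_reads [ffun i => read (t i)]) //.
  by apply/ffunP => i; rewrite /map_reads !ffunE read_map_tape.
- rewrite /map_config /=.
  by apply: (@step_yes N') qP' Dw.
- rewrite /map_config /=.
  by apply: (@step_no N') qP' Dw.
Qed.

Lemma out_map D x o : q0' = fq q0 -> out N D x o -> out N' D x o.
Proof.
move=> Eq0 [n [c [re co]]]; exists n, (map_config c); split.
  elim: re => [|{}n c1 c2 _ IH /step_map s]; last by right with (map_config c1).
  suff -> : map_config (init_config N x) = init_config N' x by left.
  rewrite /map_config /init_config /= -Eq0; congr Config; apply/ffunP => i.
  by rewrite !ffunE /map_tape /=; case: ifP => // _; rewrite -map_comp.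
by have := sim (cfg_state c); move: co; rewrite /halts_with /= => ->.
Qed.

End MapMachine.

(** With states and symbols numbered, instructions of given dimensions form a finite type, so
    machines form a countable union of finite types. *)
Definition instr_code (m g k : nat) : finType :=
  (option bool + 'I_m * 'I_m +
   {ffun {ffun 'I_k.+1 -> symbol 'I_g} -> {set action 'I_m 'I_g k.+1}})%type.

Definition machine_code (d : nat * nat * nat) : finType :=
  ('I_d.1.1 * {ffun 'I_d.1.1 -> instr_code d.1.1 d.1.2 d.2})%type.

Definition decode_instr m g k (i : instr_code m g k) : instruction 'I_m 'I_g k.+1 :=
  match i with
  | inl (inl None) => Halt Quest
  | inl (inl (Some b)) => Halt (if b then Acc else Rej)
  | inl (inr (qy, qn)) => Query qy qn
  | inr acts => Act acts
  end.

Definition decode_machine (c : {d : nat * nat * nat & machine_code d}) : machine :=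
  let: existT d (q0, prog) := c in
  @Machine 'I_d.1.1 'I_d.1.2 d.2 q0 (fun q => decode_instr (prog q)).

Section Encode.

Variable N : machine.
Let Q := state N.
Let G := aux_symbol N.
Let k := extra_tapes N.

Definition encode_instr (i : instruction Q G k.+1) : instr_code #|Q| #|G| k :=
  match i with
  | Halt Acc => inl (inl (Some true))
  | Halt Rej => inl (inl (Some false))
  | Halt Quest => inl (inl None)
  | Query qy qn => inl (inr (enum_rank qy, enum_rank qn))
  | Act acts => inr [ffun r : {ffun 'I_k.+1 -> symbol 'I_#|G|} =>
      [set a : action 'I_#|Q| 'I_#|G| k.+1 |
        (enum_val a.1.1, map_writes enum_val a.1.2, a.2)
          \in acts (map_reads enum_val r)]%SET]
  end.

Definition encode_machine : {d : nat * nat * nat & machine_code d} :=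
  existT machine_code (#|Q|, #|G|, k)
    (enum_rank (start N), [ffun q => encode_instr (program (enum_val q))]).

End Encode.

Lemma map_symbolK (H H' : Type) (f : H -> H') g :
  cancel f g -> cancel (map_symbol f) (map_symbol g).
Proof. by move=> fK [[b|h]|] //=; rewrite fK. Qed.

Lemma out_encode N D x : out (decode_machine (encode_machine N)) D x = out N D x.
Proof.
case: N => Q G k q0 prog; apply/seteqP; split=> o.
  apply: (out_map (fq := enum_val) (fg := enum_val)); last by rewrite enum_rankK.
  move=> q; rewrite ffunE /=; case: (prog _) => [[]|qy qn|acts] //=.
    by rewrite !enum_rankK.
  by exists acts => // r q' f ob; rewrite ffunE inE.
apply: (out_map (fq := enum_rank) (fg := enum_rank)) => // q.
case Eq: (prog q) => [o'|qy qn|acts]; rewrite ffunE /= enum_rankK Eq //.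
  by case: o' {Eq}.
eexists; first by [].
move=> r q' f ob; rewrite ffunE inE /= enum_rankK.
have -> : map_writes enum_val (map_writes enum_rank f) = f.
  by apply/ffunP => i; rewrite !ffunE (map_symbolK enum_rankK); case: (f i).
suff -> : map_reads enum_val (map_reads enum_rank r) = r by [].
by apply/ffunP => i; rewrite !ffunE (map_symbolK enum_rankK).
Qed.

Lemma machines_countable : exists E : nat -> machine,
  forall N, exists i, forall D x, out (E i) D x = out N D x.
Proof.
(* Numbers that code no machine are sent to [finder], an arbitrary default. *)
pose E i := if unpickle i is Some c then decode_machine c else finder.
exists E => N; exists (pickle (encode_machine N)) => D x.
by rewrite /E pickleK out_encode.
Qed.

(** * Diagonalisation *)

Lemma horner_nat_bound (p : {poly nat}) : exists C d, forall x, p.[x]%R <= C * x.+1 ^ d.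
Proof.
elim/poly_ind: p => [|p c [C [d le_p]]]; first by exists 0, 0 => x; rewrite horner0.
exists (C + c), d.+1 => x; rewrite hornerMXaddC mulnDl.
apply: leq_add; last by rewrite leq_pmulr ?expn_gt0.
by rewrite expnSr mulnA; apply: leq_mul => //; apply: leqnSn.
Qed.

Lemma sqr_le_exp2 t : 4 <= t -> t * t <= 2 ^ t.
Proof.
elim: t => [//|t IHt]; rewrite leq_eqVlt => /predU1P[<- //|lt_t].
by have := IHt lt_t; rewrite expnS; nia.
Qed.

Lemma exp2_dominates (p : {poly nat}) L : exists2 l, L <= l &
  2 * (p.[l.*2.+1]%R * l.*2.+2) < 2 ^ l.
Proof.
have [C [d le_p]] := horner_nat_bound p.
pose t := 2 * C + d + L + 5; have le_t : t * t <= 2 ^ t by apply: sqr_le_exp2; rewrite /t; lia.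
have lt_t : t < 2 ^ t by apply: ltn_expl.
(* This makes 2l+2 the power [2 ^ t.+1], so only exponents remain to be compared: 2C + (t+1)(d+1) <=
   2^t - 1, which follows from t^2 <= 2^t. *)
exists (2 ^ t).-1; first by rewrite /t in lt_t *; lia.
have -> : (2 ^ t).-1.*2.+2 = 2 ^ t.+1 by rewrite expnS; lia.
apply: (@leq_ltn_trans (2 * C * 2 ^ (t.+1 * d.+1))).
  have := le_p (2 ^ t).-1.*2.+1.
  have -> : (2 ^ t).-1.*2.+2 = 2 ^ t.+1 by rewrite expnS; lia.
  rewrite mulnS expnD expnM; move: (2 ^ t.+1) (_ ^ d) => u v; nia.
apply: (@leq_trans (2 ^ (2 * C) * 2 ^ (t.+1 * d.+1))).
  by rewrite ltn_mul2r expn_gt0 /= ltn_expl.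
rewrite -expnD leq_exp2l //; rewrite /t in le_t lt_t *; nia.
Qed.

(** * Defeating one machine at one length *)

Definition behaviour := language -> word -> set outcome.

Definition certified (B : behaviour) (p : {poly nat}) : Prop :=
  forall D x o, B D x o -> exists S : seq word, [/\ size S <= p.[size x]%R,
    forall w, w \in S -> size w <= p.[size x]%R &
    forall D' : language, (forall w, w \in S -> D w <-> D' w) -> B D' x o].

Definition correct (B : behaviour) (D : language) (x : word) : Prop :=
  (B D x Acc \/ B D x Rej) /\ (B D x Acc <-> out finder D x Acc).

Definition never_both (B : behaviour) : Prop :=
  forall D x, ~ (B D x Acc /\ B D x Rej).

Definition patch n (Z : edges n) (D : language) : language :=
  fun w => if size w == n.+1 then is_true (edge_pred Z w) else D w.

Lemma verdict_patch n (Z : edges n) D v : size v = n ->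
  verdict (oracle_pred (patch Z D)) v = verdict (edge_pred Z) v.
Proof.
move=> sv; rewrite /verdict (@eq_violated n _ (edge_pred Z)) // => w sw.
by rewrite /oracle_pred /patch sw eqxx asboolb.
Qed.

Lemma defeat (B : behaviour) p l D : certified B p -> never_both B ->
    2 * (p.[l.*2.+1]%R * l.*2.+2) < 2 ^ l ->
  exists (Z : edges l.*2.+1) v, [/\ size v = l.*2.+1, uviol Z v &
    ~ correct B (patch Z D) (nseq l.*2.+1 false)].
Proof.
set n := l.*2.+1; set x := nseq n false; set k := (p.[n])%R => certB notboth lt_k.
apply: contrapT => noZ.
have corr (Z : edges n) v : size v = n -> uviol Z v -> correct B (patch Z D) x.
  by move=> sv uZ; apply: contrapT => bad; apply: noZ; exists Z, v.
(* The empty list is the default when [o] does not occur, so that certificates become total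
   functions of [Z]. *)
have certs o (Z : edges n) : exists S : seq word, size S <= k /\
    (B (patch Z D) x o -> forall D' : language,
      (forall w, w \in S -> patch Z D w <-> D' w) -> B D' x o).
  have [/certB[S [szS _ agree]]|noB] := pselect (B (patch Z D) x o).
    by exists S; split=> //; rewrite size_nseq in szS.
  by exists [::].
have [[S SP] [T TP]] := (choice (certs Acc), choice (certs Rej)).
have [|||Z [Z' [a [b [uZ uZ' agree]]]]] := @unseparated_pair l k S T.
- by move=> Z; case: (SP Z).
- by move=> Z; case: (TP Z).
- exact: lt_k.
have acc : B (patch Z D) x Acc.
  apply/(corr _ _ (size_hi a) uZ).2/finder_outP.
  exists (hi l a); first by rewrite size_hi size_nseq.
  rewrite verdict_patch ?size_hi //.
  move/uviolP: uZ => /(_ _ (size_hi a)); rewrite /verdict eqxx => ->.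
  by rewrite /hi last_cat last_rcons.
(* Acceptance would need a violated vertex ending in 1, but the only violated one is [lo l b];
   correctness then leaves [Rej]. *)
have rej : B (patch Z' D) x Rej.
  have [[accN|//] [/(_ accN)/finder_outP[v sv]]] := corr _ _ (size_lo b) uZ'.
  rewrite size_nseq in sv; rewrite verdict_patch // /verdict.
  move/uviolP: uZ' => /(_ _ sv) ->; case: eqP => // ->.
  by rewrite /lo last_cat /= (_ : last _ _ = false) //; elim: (l).
(* Both certificates hold for this oracle: on words common to them, [Z] and [Z'] agree. *)
pose D' : language := fun w => if w \in S Z then patch Z D w else patch Z' D w.
apply: (notboth D' x); split.
- by apply: (SP Z).2 acc _ _ => w wS; rewrite /D' wS.
- apply: (TP Z').2 rej _ _ => w wT; rewrite /D'; case: ifP => // wS.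
  by rewrite /patch agree.
Qed.

(** A machine with no outcome could be run on past its time bound. *)
Lemma NPTM_out_ex N D x : is_NPTM N -> exists o, out N D x o.
Proof.
move=> [halts [p le_p]]; apply: contrapT => noout.
have re n : exists c, @reaches N D x n c.
  elim: n => [|n [c re]]; first by exists (init_config N x); left.
  apply: contrapT => stuck; case: (halts D x n c re) => [c' s|o co].
    by apply: stuck; exists c'; right with c.
  by apply: noout; exists o, n, c.
by have [c /le_p] := re (p.[size x]%R).+1; rewrite ltnn.
Qed.

Lemma behaviours : exists (B : nat -> behaviour) (p : nat -> {poly nat}),
  forall N, is_NPTM N -> exists i, B i = out N /\ certified (B i) (p i).
Proof.
have [E EP] := machines_countable.
have /choice[p pP] (i : nat) : exists p : {poly nat},
    (exists q, certified (out (E i)) q) -> certified (out (E i)) p.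
  have [[q qP]|no] := pselect (exists q, certified (out (E i)) q).
    by exists q.
  by exists 0%R => /no.
exists (fun i => out (E i)), p => N NP; have [i iP] := EP N.
have BE : out (E i) = out N by apply/funext => D; apply/funext => x.
exists i; split=> //; apply: pP; rewrite BE.
by have [q qP] := out_certificate NP; exists q.
Qed.

(** * Building the oracle in stages *)

Lemma unique_violation_underproductive D x v :
  (forall w, size w = size x -> violated (oracle_pred D) w = (w == v)) ->
  ~ (out finder D x Acc /\ out finder D x Rej).
Proof.
move=> uv [/finder_outP[a sa Ea] /finder_outP[b sb Eb]].
move: Ea Eb; rewrite /verdict !uv //.
by case: eqP => // ->; case: eqP => // ->; case: last.
Qed.

Lemma agree_violated n (D D' : language) v : size v = n ->
  (forall w, size w = n.+1 -> D w <-> D' w) ->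
  violated (oracle_pred D) v = violated (oracle_pred D') v.
Proof.
move=> sv DD'; apply: (@eq_violated n) => // w /DD' E.
by rewrite /oracle_pred; apply/asboolP/asboolP => /E.
Qed.

(** The unique violation is required even when [B] need not be defeated, since [finder] must be
    underproductive on the final oracle at every length. *)
Definition stage (B : behaviour) p n (D D' : language) : Prop :=
  [/\ forall w, size w != n.+1 -> D' w <-> D w,
      exists v, forall w, size w = n -> violated (oracle_pred D') w = (w == v) &
      certified B p -> never_both B -> ~ correct B D' (nseq n false)].

Lemma stage_ex B p l D : 2 * (p.[l.*2.+1]%R * l.*2.+2) < 2 ^ l ->
  exists D', stage B p l.*2.+1 D D'.
Proof.
set n := l.*2.+1 => lt_l.
have patchP (Z : edges n) v : uviol Z v -> (certified B p -> never_both B ->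
    ~ correct B (patch Z D) (nseq n false)) -> exists D', stage B p n D D'.
  move=> /uviolP uZ bad; exists (patch Z D); split=> //.
    by move=> w; rewrite /patch => /negPf ->.
  exists v => w sw; rewrite -uZ //; apply: (@eq_violated n) => // w' sw'.
  by rewrite /oracle_pred /patch sw' eqxx asboolb.
have [[cB nB]|nocert] := pselect (certified B p /\ never_both B).
  by have [Z [v [_ uZ bad]]] := defeat D cB nB lt_l; apply: patchP uZ _.
have /card_gt0P[Z uZ] := card_uviol_gt0 (size_nseq n false).
by apply: patchP uZ _ => cB nB; case: nocert.
Qed.

Section Diagonal.

Variables (B : nat -> behaviour) (p : nat -> {poly nat}).
Variables (len : nat -> nat) (next : nat -> language -> language).
Hypothesis len_lt : forall i, len i + (p i).[len i]%R < len i.+1.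
Hypothesis nextP : forall i D, stage (B i) (p i) (len i) D (next i D).

Fixpoint approx i : language := if i is j.+1 then next j (approx j) else set0.

(** Stage [size w] settles [w]: stages from there on change only longer words, because
    [i <= len i]. *)
Definition diagonal : language := fun w => approx (size w) w.

Lemma len_homo : {homo len : i j / i < j}.
Proof. apply: homo_ltn => [|i]; first exact: ltn_trans.
by apply: leq_ltn_trans (leq_addr _ _) (len_lt i). Qed.

Lemma le_len i : i <= len i.
Proof. by elim: i => // i IHi; apply: leq_ltn_trans IHi (len_homo _). Qed.

Lemma approx_stable w i k : size w <= len i -> approx (i + k) w <-> approx i w.
Proof.
move=> sw; elim: k => [|k IHk]; rewrite ?addn0 // addnS -IHk /=.
have [off _ _] := nextP (i + k) (approx (i + k)); apply: off.
suff : len i <= len (i + k) by lia.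
by case: k {IHk} => [|k]; rewrite ?addn0 // addnS ltnW // len_homo // ltnS leq_addr.
Qed.

Lemma diagonal_approx w i : size w <= len i -> diagonal w <-> approx i w.
Proof.
move=> sw; rewrite /diagonal; have [le|/ltnW le] := leqP (size w) i.
  by rewrite -(subnKC le) approx_stable // le_len.
by rewrite -{1}(subnKC le) approx_stable.
Qed.

Lemma approx_size i w : approx i w -> exists j, size w = (len j).+1.
Proof.
elim: i => //= i IHi; have [off _ _] := nextP i (approx i).
by case: (eqVneq (size w) (len i).+1) => [? _|/off -> //]; exists i.
Qed.

(** At a length [len i] the stage provides the vertex; at any other length no edge is selected and
    0..0 is it. *)
Lemma diagonal_unique n : exists v, forall w, size w = n ->
  violated (oracle_pred diagonal) w = (w == v).
Proof.
have [[i <-]|no] := pselect (exists i, len i = n).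
  have [_ [v vP] _] := nextP i (approx i); exists v => w sw; rewrite -vP //.
  apply: agree_violated sw _ => w' sw'.
  by apply: (@diagonal_approx _ i.+1); rewrite sw' len_homo.
exists (nseq n false) => w sw; rewrite (@agree_violated n _ set0) //; last first.
  move=> w' sw'; split=> // /approx_size[j]; rewrite sw' => -[Ej].
  by apply: no; exists j.
rewrite /violated /boundary /oracle_pred !asboolF // addbF -{1}sw.
by elim: w n sw {no} => [[]|[] w IHw [|n]] //= [] // /IHw; rewrite eqseq_cons.
Qed.

(** Up to length [len i.+1] the final oracle is that of stage [i.+1]. By [len_lt] this covers every
    certificate of [B i] on this input and all edges that [finder] queries, so the defeat
    persists. *)
Lemma diagonal_incorrect i : certified (B i) (p i) -> never_both (B i) ->
  ~ correct (B i) diagonal (nseq (len i) false).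
Proof.
move=> cB nB [yes acc]; set x := nseq _ _ in yes acc.
have [_ _ /(_ cB nB)] := nextP i (approx i); apply.
have agree w : size w <= len i.+1 -> diagonal w <-> approx i.+1 w by exact: diagonal_approx.
have sx : size x = len i by rewrite size_nseq.
have le_p w : size w <= (p i).[size x]%R -> size w <= len i.+1.
  by rewrite sx => /leq_trans; apply; apply: ltnW (leq_ltn_trans (leq_addl _ _) (len_lt i)).
have BE o : B i diagonal x o <-> B i (next i (approx i)) x o.
  by split=> /cB[S [_ szS]]; apply=> w /szS/le_p/agree[? ?]; split.
have FE : out finder diagonal x Acc <-> out finder (next i (approx i)) x Acc.
  have E v : size v = size x -> verdict (oracle_pred diagonal) v =
      verdict (oracle_pred (next i (approx i))) v.
    move=> sv; rewrite /verdict (@agree_violated (len i) _ (approx i.+1)) ?sv // => w sw.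
    by apply: agree; rewrite sw len_homo.
  by split=> /finder_outP[v sv Ev]; apply/finder_outP; exists v; rewrite ?E // -?E.
by split; [case: yes => /BE; [left|right] | rewrite -BE -FE].
Qed.

End Diagonal.

Theorem theorem4p7 :
  exists X Y : language, le_O X Y /\ ~ le_U X Y.
Proof.
have [B [p BP]] := behaviours.
have /choice[g gP] (qL : {poly nat} * nat) : exists l, qL.2 <= l /\
    2 * (qL.1.[l.*2.+1]%R * l.*2.+2) < 2 ^ l.
  by case: qL => q L; have [l ? ?] := exp2_dominates q L; exists l.
(* The lower bound given to [g] is [len j] plus the bound on the query lengths at stage [j], which
   keeps later stages out of reach. *)
pose half := fix half i := if i is j.+1
  then g (p j.+1, (half j).*2.+1 + (p j).[(half j).*2.+1]%R) else g (p 0, 0).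
pose len i := (half i).*2.+1.
have len_lt i : len i + (p i).[len i]%R < len i.+1.
  have := (gP (p i.+1, len i + (p i).[len i]%R)).1.
  by rewrite ltnS => /leq_trans; apply; rewrite -addnn leq_addr.
have halfP i : 2 * ((p i).[len i]%R * (len i).+1) < 2 ^ half i.
  by case: i => [|i]; exact: (gP (_, _)).2.
have /choice[nxt nxtP] (iD : nat * language) : exists D',
    stage (B iD.1) (p iD.1) (len iD.1) iD.2 D'.
  exact: stage_ex (halfP iD.1).
pose next i D := nxt (i, D).
have nextP i D : stage (B i) (p i) (len i) D (next i D) by exact: (nxtP (i, D)).
set Y := diagonal next; exists (lang_of finder Y), Y.
have under x : ~ (out finder Y x Acc /\ out finder Y x Rej).
  have [v vP] := diagonal_unique len_lt nextP (size x).
  exact: unique_violation_underproductive vP.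
split.
  exists finder; split; last exact: finder_overproductive.
  split=> //; [exact: finder_NPTM|exact: finder_overproductive|].
  by move=> x both; apply: (under x); split; apply: both; [left|right].
move=> [M [[MP over _ XE] robust]]; have [i [BE cB]] := BP M MP.
apply: (diagonal_incorrect len_lt nextP cB).
  by rewrite BE => D x [acc rej]; apply: (robust D x) => o [->|->].
rewrite BE; split; last first.
  by rewrite -[out M Y _ Acc]/(lang_of M Y _) -XE.
(* With neither [Acc] nor [Rej], the nonempty outcome set would be exactly that of [Quest], against
   overproductivity. *)
set x := nseq _ _; apply: contrapT => /not_orP[nacc nrej]; apply: (over x).
have outQ o : out M Y x o -> o = Quest by case: o.
apply/seteqP; split=> [o /outQ //|_ ->].
by have [o oo] := NPTM_out_ex Y x MP; rewrite -(outQ _ oo).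
Qed.
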